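(* Let $l=5$, $r\in\{1,2\}$ and $a=[r]$. Then $p_{16,4}(1/a)$ and $p_{32,12}(1/a)$ are in $S$.
   Context: For an integer $i$, $[i]=\sum x^{n^2}\in\mathbb{Z}/2[[x]]$, summed over $n\in\mathbb{Z}$ with $n\equiv i\pmod 5$. $S$ is the subring of $\mathbb{Z}/2[[x]]$ generated over $\mathbb{Z}/2$ by $[1]$ and $[2]$. $1/a$ is taken in the field $L$ of Laurent series over $\mathbb{Z}/2$. For $q$ a power of $2$ and $0\le j<q$, $p_{q,j}:L\to L$ is $\sum_n c_nx^n\mapsto\sum_{n\equiv j\pmod q}c_nx^n$. *)

(* Defs.v *)
From HB Require Import structures.
From mathcomp Require Import all_boot all_order all_algebra.
From mathcomp Require Import all_classical.
From mathcomp Require Import zify ring.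

Set Implicit Arguments.
Unset Strict Implicit.
Unset Printing Implicit Defensive.

Import Order.TTheory GRing.Theory Num.Theory.

Local Open Scope classical_set_scope.
Local Open Scope ring_scope.

(* Formal Laurent series over a field F are the coefficient families           *)
(* f : int -> F that vanish below some exponent; f n is the coefficient of x^n.*)
Definition vanish_below (F : fieldType) (M : int) (f : int -> F) : Prop :=
  forall n, n < M -> f n = 0.

Definition laurent_pred (F : fieldType) : {pred int -> F} :=
  fun f => `[< exists M, vanish_below M f >].
Arguments laurent_pred F : clear implicits.

Record laurent (F : fieldType) := Laurent {
  lcoef :> int -> F ;
  _ : lcoef \in laurent_pred F }.

HB.instance Definition _ (F : fieldType) := [isSub for @lcoef F].
HB.instance Definition _ (F : fieldType) := [Choice of laurent F by <:].

Lemma laurentP (F : fieldType) (f g : laurent F) :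
  (forall n, f n = g n) -> f = g.
Proof. by move=> fg; apply/val_inj/funext. Qed.

Lemma laurent_bound (F : fieldType) (f : laurent F) :
  exists M, vanish_below M f.
Proof. by case: f => f /= /asboolP. Qed.

Lemma mem_laurent (F : fieldType) (f : int -> F) M :
  vanish_below M f -> f \in laurent_pred F.
Proof. by move=> fM; apply/asboolP; exists M. Qed.

Lemma laurent_zmod_closed (F : fieldType) : zmod_closed (laurent_pred F).
Proof.
split=> [|f g /asboolP[M fM] /asboolP[N gN]]; first exact: (@mem_laurent _ _ 0).
apply: (@mem_laurent _ _ (Num.min M N)) => n; rewrite lt_min => /andP[nM nN].
have -> : (f - g) n = f n - g n by [].
by rewrite fM // gN // subr0.
Qed.

HB.instance Definition _ (F : fieldType) :=
  GRing.isZmodClosed.Build (int -> F) (laurent_pred F)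
    (@laurent_zmod_closed F).
HB.instance Definition _ (F : fieldType) :=
  [SubChoice_isSubZmodule of laurent F by <:].

Section LaurentField.
Variable F : fieldType.
Implicit Types (f g h : laurent F).

Definition laurentC_fun (c : F) (n : int) : F := if n == 0 then c else 0.

Lemma laurentC_subproof c : laurentC_fun c \in laurent_pred F.
Proof.
by apply: (@mem_laurent _ _ 0) => n n0; rewrite /laurentC_fun lt_eqF.
Qed.

(* The constant series c. *)
Definition laurentC (c : F) : laurent F := Laurent (laurentC_subproof c).

(* The sum has finitely many nonzero terms, so it is a genuine sum. *)
Definition laurent_mul_fun f g (n : int) : F :=
  \sum_(i \in [set: int]) f i * g (n - i).

Lemma laurent_mul_fun_lt f g M N n : vanish_below M f -> vanish_below N g ->
  n < M + N -> laurent_mul_fun f g n = 0.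
Proof.
move=> fM gN ltn; apply: fsbig1 => i _.
have [/fM->|Mi] := ltP i M; first by rewrite mul0r.
by rewrite (gN (n - i)) ?mulr0 //; lia.
Qed.

Lemma laurent_mul_funE f g M N (k : nat) :
  vanish_below M f -> vanish_below N g ->
  laurent_mul_fun f g (M + N + k%:Z) =
    \sum_(i < k.+1) f (M + i%:Z) * g (N + (k - i)%N%:Z).
Proof.
move=> fM gN; rewrite /laurent_mul_fun.
pose r := [seq M + i%:Z | i <- iota 0 k.+1].
rewrite -(fsbig_widen [set` r] setT) //; last first.
  move=> i /= [_ ir]; have [/fM->|Mi] := ltP i M; first by rewrite mul0r.
  rewrite (gN (_ - i)) ?mulr0 // ltNge; apply/negP => Ni; apply: ir.
  by apply/mapP; exists `|i - M|%N; rewrite ?mem_iota; lia.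
rewrite -fsbig_seq; last by rewrite map_inj_uniq ?iota_uniq // => i j; lia.
rewrite big_map -[iota _ _]/(index_iota 0 k.+1) big_mkord; apply: eq_bigr => i _.
by congr (_ * g _); have := ltn_ord i; lia.
Qed.

Lemma laurent_mul_subproof f g : laurent_mul_fun f g \in laurent_pred F.
Proof.
have [M fM] := laurent_bound f; have [N gN] := laurent_bound g.
by apply: (@mem_laurent _ _ (M + N)) => n; apply: laurent_mul_fun_lt.
Qed.

Definition laurent_mul f g : laurent F := Laurent (laurent_mul_subproof f g).

Let trunc (K : nat) (M : int) f : {poly F} := \poly_(i < K) f (M + i%:Z).

Let laurent_mul_trunc f g M N (k K : nat) :
  vanish_below M f -> vanish_below N g -> (k < K)%N ->
  laurent_mul f g (M + N + k%:Z) = (trunc K M f * trunc K N g)`_k.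
Proof.
move=> fM gN kK; rewrite [LHS](laurent_mul_funE k fM gN) coefM.
by apply: eq_bigr => i _; rewrite !coef_poly !ifT //; have := ltn_ord i; lia.
Qed.

Let vanish_mul f g M N : vanish_below M f -> vanish_below N g ->
  vanish_below (M + N) (laurent_mul f g).
Proof. by move=> fM gN n; apply: laurent_mul_fun_lt. Qed.

Let int_ge (M n : int) : M <= n -> exists k : nat, n = M + k%:Z.
Proof. by move=> Mn; exists `|n - M|%N; lia. Qed.

Lemma laurent_mulC : commutative laurent_mul.
Proof.
move=> f g; have [M fM] := laurent_bound f; have [N gN] := laurent_bound g.
apply: laurentP => n; have [nMN|/int_ge[k ->]] := ltP n (M + N).
  by rewrite (vanish_mul fM gN) // (vanish_mul gN fM) // addrC.
rewrite (laurent_mul_trunc fM gN (ltnSn k)) [M + N]addrC.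
by rewrite (laurent_mul_trunc gN fM (ltnSn k)) mulrC.
Qed.

Lemma laurent_mulA : associative laurent_mul.
Proof.
move=> f g h; have [M fM] := laurent_bound f.
have [N gN] := laurent_bound g; have [P hP] := laurent_bound h.
have fgM := vanish_mul fM gN; have ghN := vanish_mul gN hP.
apply: laurentP => n; have [nMN|/int_ge[k ->]] := ltP n (M + N + P).
  by rewrite (vanish_mul fM ghN) 1?(vanish_mul fgM hP) // addrA.
rewrite (laurent_mul_trunc fgM hP (ltnSn k)) -[M + N + P]addrA.
rewrite (laurent_mul_trunc fM ghN (ltnSn k)).
transitivity ((trunc k.+1 M f * trunc k.+1 N g * trunc k.+1 P h)`_k).
  rewrite -mulrA coefM [RHS]coefM; apply: eq_bigr => i _; congr (_ * _).
  have lk : (k - i < k.+1)%N by lia.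
  by rewrite coef_poly lk (laurent_mul_trunc gN hP lk).
rewrite coefM [RHS]coefM; apply: eq_bigr => i _; congr (_ * _).
by rewrite coef_poly ltn_ord (laurent_mul_trunc fM gN (ltn_ord i)).
Qed.

Lemma laurent_mul1 : left_id (laurentC 1) laurent_mul.
Proof.
move=> f; apply: laurentP => n /=; rewrite /laurent_mul_fun.
rewrite -(fsbig_widen [set 0] setT) //.
  by rewrite fsbig_set1 /= /laurentC_fun eqxx mul1r subr0.
by move=> i /= [_ /eqP/negbTE i0]; rewrite /laurentC_fun i0 mul0r.
Qed.

Lemma laurent_mulDl : left_distributive laurent_mul +%R.
Proof.
move=> f g h; have [M fM] := laurent_bound f.
have [N gN] := laurent_bound g; have [P hP] := laurent_bound h.
pose Q := Num.min M N.
have fQ : vanish_below Q f by move=> n; rewrite lt_min => /andP[/fM].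
have gQ : vanish_below Q g by move=> n; rewrite lt_min => /andP[_ /gN].
have fgQ : vanish_below Q (f + g).
  move=> n nQ; have -> : (f + g) n = f n + g n by [].
  by rewrite fQ // gQ // addr0.
apply: laurentP => n.
have -> : (laurent_mul f h + laurent_mul g h) n =
  laurent_mul f h n + laurent_mul g h n by [].
have [nQ|/int_ge[k ->]] := ltP n (Q + P).
  by rewrite !(vanish_mul _ hP nQ) // addr0.
rewrite /= (laurent_mul_funE k fgQ hP) (laurent_mul_funE k fQ hP).
rewrite (laurent_mul_funE k gQ hP) -big_split; apply: eq_bigr => i _.
exact: mulrDl.
Qed.

Lemma laurent_oner_neq0 : laurentC 1 != 0.
Proof. by apply/eqP => /(congr1 (fun f => lcoef f 0))/eqP; rewrite oner_eq0. Qed.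

HB.instance Definition _ := GRing.Zmodule_isComNzRing.Build (laurent F)
  laurent_mulA laurent_mulC laurent_mul1 laurent_mulDl laurent_oner_neq0.

Lemma laurent_order f : f != 0 -> exists2 M, vanish_below M f & f M != 0.
Proof.
move=> f0; have [M fM] := laurent_bound f.
have ex_k : exists k : nat, f (M + k%:Z) != 0.
  apply: contrapT => /forallNP nof; move/eqP: f0; apply; apply: laurentP => n.
  have [/fM->//|/int_ge[k ->]] := ltP n M.
  by have /negP := nof k; rewrite negbK => /eqP.
exists (M + (ex_minn ex_k)%:Z); case: ex_minnP => // k _ kmin n nMk.
have [/fM//|/int_ge[j nE]] := ltP n M.
apply/eqP; rewrite nE; apply: contraTT nMk => /kmin.
by rewrite nE; lia.
Qed.

Lemma laurent_inv_exists f : f != 0 -> exists g, g * f = 1.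
Proof.
case/laurent_order => M fM fM0.
pose step (s : seq F) := rcons s (((size s == 0)%:R -
  \sum_(i < size s) f (M + (size s - i)%N%:Z) * s`_i) / f M).
pose s k := iter k step [::]; pose u k := (s k.+1)`_k.
have size_s k : size (s k) = k by elim: k => //= k IHk; rewrite size_rcons IHk.
have nth_s k i : (i < k)%N -> (s k)`_i = u i.
  elim: k => // k IHk; rewrite ltnS leq_eqVlt => /predU1P[->//|ik].
  by rewrite [LHS]nth_rcons size_s ik IHk.
have uE k : u k * f M = (k == 0)%:R -
    \sum_(i < k) f (M + (k - i)%N%:Z) * u i.
  rewrite {1}/u [(s _)`_k]nth_rcons size_s ltnn eqxx mulfVK //.
  by congr (_ - _); apply: eq_bigr => i _; rewrite nth_s.
pose gf (n : int) := if n < - M then 0 else u (absz (n + M)).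
have gfM : vanish_below (- M) gf by move=> n; rewrite /gf => ->.
pose g := Laurent (mem_laurent gfM).
exists g; apply: laurentP => n.
have gM : vanish_below (- M) g by [].
have gu (i : nat) : g (- M + i%:Z) = u i.
  by rewrite /g /= /gf ifF; [congr (u _)|]; lia.
clearbody g.
have -> : (g * f) n = laurent_mul_fun g f n by [].
have -> : (1 : laurent F) n = (n == 0)%:R.
  by rewrite [LHS]/= /laurentC_fun; case: (n == 0).
have [n0|/int_ge[k ->]] := ltP n 0.
  by rewrite (laurent_mul_fun_lt gM fM) ?addNr // lt_eqF.
rewrite -[X in X + _](addNr M) (laurent_mul_funE k gM fM) big_ord_recr /=.
rewrite gu subnn addr0 uE addNr add0r -[k%:Z == 0]/(k == 0)%N.
rewrite addrCA -[RHS]addr0; congr (_ + _); apply/eqP; rewrite subr_eq0; apply/eqP.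
by apply: eq_bigr => i _; rewrite gu mulrC.
Qed.

Definition laurent_inv f : laurent F :=
  if pselect (f != 0) is left f0 then sval (cid (laurent_inv_exists f0)) else 0.

Lemma laurent_mulVf f : f != 0 -> laurent_inv f * f = 1.
Proof.
rewrite /laurent_inv => f0; case: pselect => // f0'.
by case: cid.
Qed.

Lemma laurent_invr0 : laurent_inv 0 = 0.
Proof. by rewrite /laurent_inv; case: pselect => // f0; case/eqP: (f0). Qed.

HB.instance Definition _ := GRing.ComNzRing_isField.Build (laurent F)
  laurent_mulVf laurent_invr0.

(* p_{q,j}: keep the exponents congruent to j modulo q. *)
Definition residue_part_fun (q j : nat) f (n : int) : F :=
  if (n == j%:Z %[mod q%:Z])%Z then f n else 0.

Lemma residue_part_subproof q j f : residue_part_fun q j f \in laurent_pred F.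
Proof.
have [M fM] := laurent_bound f; apply: (@mem_laurent _ _ M) => n nM.
by rewrite /residue_part_fun fM // if_same.
Qed.

Definition residue_part q j f : laurent F :=
  Laurent (residue_part_subproof q j f).

End LaurentField.

(* [i]: the coefficient of x^m counts, modulo 2, the n : int with              *)
(* n = i mod 5 and n^2 = m; there are at most two of them.                     *)
Definition theta_fun (i m : int) : 'F_2 :=
  \sum_(n \in [set n : int | (n = i %[mod 5])%Z /\ n ^+ 2 = m]) (1 : 'F_2).

Lemma theta_fun_vanish i : vanish_below 0 (theta_fun i).
Proof.
move=> m m0; rewrite /theta_fun.
rewrite (_ : [set n : int | _] = set0) ?fsbig_set0 //.
by apply/seteqP; split=> n //= -[_ nm]; move: m0; rewrite -nm ltNge sqr_ge0.
Qed.

Definition theta (i : int) : laurent 'F_2 :=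
  Laurent (mem_laurent (@theta_fun_vanish i)).

Definition subring_over_F2 (A : set (laurent 'F_2)) : Prop :=
  subring_closed (mem A) /\ forall c : 'F_2, A (laurentC c).

(* The ring S = Z/2[ [1], [2] ], as a set of Laurent series; the lemma         *)
(* theta_ring_powerseries below confirms that it lies in Z/2[[x]].             *)
Definition theta_ring : set (laurent 'F_2) :=
  smallest subring_over_F2 [set theta 1; theta 2].

Lemma theta_ring_powerseries (f : laurent 'F_2) :
  theta_ring f -> vanish_below 0 f.
Proof.
apply: (smallest_sub (X := [set f : laurent 'F_2 | vanish_below 0 f])).
  split; last by move=> c n n0; rewrite /= /laurentC_fun lt_eqF.
  split=> [|f1 g1|f1 g1]; rewrite !inE.
  - by move=> n n0; rewrite /= /laurentC_fun lt_eqF.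
  - move=> f0 g0 n n0; have -> : (f1 - g1) n = f1 n - g1 n by [].
    by rewrite f0 // g0 // subr0.
  - move=> f0 g0 n n0; exact: (laurent_mul_fun_lt f0 g0).
by move=> _ /= [->|->]; exact: theta_fun_vanish.
Qed.

(* Main.v *)
(* Let a = [1], b = [2], p = ab, s = a^5 + b^5, A = a + b^4 and B = b + a^4.
   The even part of [i] is [2i]^4, so A and B are the odd parts of a and b and
   have all their exponents congruent to 1 modulo 8.  A rotation of the lattice
   Z[i] gives AB = s^2, whence s = p + p^2; moreover s = B b^4 + A a^4 has its
   exponents congruent to 1 modulo 4.
   As a = A + b^4, expanding 1/a = a^3/a^4 shows that its exponents divisible
   by 4 make up (b^3/a)^4, and
     b^3/a = p^3/a^4 = s b^4 + s^2 (A + B b^8) + s^6 B/a^8 + b^4,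
   where the four terms lie in the classes 1 mod 4, 3 mod 8, 7 mod 8 and
   0 mod 4.  Hence p_{16,4}(1/a) = (s b^4)^4 and
   p_{32,12}(1/a) = (s^2 (A + B b^8))^4.  The situation is symmetric in a, b. *)
Require Import Defs.
From mathcomp Require Import all_boot all_order all_algebra.
From mathcomp Require Import all_classical.
From mathcomp Require Import zify ring.

Set Implicit Arguments.
Unset Strict Implicit.
Unset Printing Implicit Defensive.

Import Order.TTheory GRing.Theory Num.Theory.

Local Open Scope classical_set_scope.
Local Open Scope ring_scope.

(** * Frobenius on Laurent series over the field with two elements *)

Lemma pchar_F2 : 2%N \in [pchar 'F_2].
Proof. exact: pchar_Fp. Qed.

(** The sum is the coefficient of [x^k] in the square of the polynomial with coefficients [u i]. By
    Frobenius that square has coefficient [u i ^+ 2 = u i] at [x^(2i)], and nothing at odd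
    exponents. *)
Lemma sum_sqr_F2 (u : nat -> 'F_2) k :
  \sum_(i < k.+1) u i * u (k - i)%N = if odd k then 0 else u k./2.
Proof.
have ch : 2%N \in [pchar {poly 'F_2}] by rewrite pchar_poly.
pose P := \poly_(i < k.+1) u i.
transitivity ((P ^+ 2)`_k).
  rewrite expr2 coefM; apply: eq_bigr => i _.
  by rewrite !coef_poly ltn_ord ltnS leq_subr.
rewrite -(pFrobenius_autE ch) /P poly_def rmorph_sum /=.
rewrite coef_sum.
under eq_bigr => i _.
  rewrite pFrobenius_autE exprZn -exprM coefZ coefXn.
  over.
case: ifPn => [k1|k0].
  apply: big1 => i _; case: eqP => [kE|]; last by rewrite mulr0.
  by move/(congr1 odd): kE; rewrite oddM andbF k1.
have lk : (k./2 < k.+1)%N by lia.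
rewrite (bigD1 (Ordinal lk)) //= big1 => [|i /eqP ik].
  rewrite addr0.
  have -> : (u k./2 ^+ 2) = u k./2 by case: (u k./2) => [[|[|]]] // ?; apply/val_inj.
  by rewrite (_ : (k == _) = true) ?mulr1 //; lia.
case: eqP => [kE|]; last by rewrite mulr0.
by case: ik; apply/val_inj => /=; lia.
Qed.

Lemma laurent_addE (F : fieldType) (f g : laurent F) n : (f + g) n = f n + g n.
Proof. by []. Qed.

Lemma laurent_sqrE (f : laurent 'F_2) n :
  (f ^+ 2) n = if (2 %| n)%Z then f (n %/ 2)%Z else 0.
Proof.
have [M fM] := laurent_bound f; rewrite expr2.
have -> : (f * f) n = laurent_mul_fun f f n by [].
have [nM|Mn] := ltP n (M + M).
  rewrite (laurent_mul_fun_lt fM fM nM); case: ifP => // n2.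
  by rewrite fM //; lia.
have {Mn} [k ->] : exists k : nat, n = M + M + k%:Z by exists (absz (n - M - M)%R); lia.
(* Coefficients are counted from [M] in [f] and from [2M] in its square, so [k = n - 2M] has the
   parity of [n] and [M + k./2] is half of [n]. *)
rewrite (laurent_mul_funE _ fM fM) (sum_sqr_F2 (fun i => f (M + i%:Z))).
case: ifPn => ko; case: ifPn => kn; try by lia.
  by [].
by congr (f _); lia.
Qed.

Lemma laurent_pow4E (f : laurent 'F_2) n :
  (f ^+ 4) n = if (4 %| n)%Z then f (n %/ 4)%Z else 0.
Proof.
rewrite -[4%N]/(2 * 2)%N exprM !laurent_sqrE.
case: ifPn => n2; last by rewrite ifF //; lia.
case: ifPn => n4; case: ifPn => n4'; try lia; last by [].
by congr (f _); lia.
Qed.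

Lemma laurent_pow4D (f g : laurent 'F_2) : (f + g) ^+ 4 = f ^+ 4 + g ^+ 4.
Proof.
apply: laurentP => n; rewrite laurent_addE !laurent_pow4E.
by case: ifP => _; rewrite ?addr0 // laurent_addE.
Qed.

Lemma laurent_addff (f : laurent 'F_2) : f + f = 0.
Proof. by apply: laurentP => n; rewrite laurent_addE (addrr_pchar2 pchar_F2). Qed.

(** * Exponents in residue classes *)

Definition supported (F : fieldType) (q j : int) (f : laurent F) :=
  forall n, f n != 0 -> (n = j %[mod q])%Z.

(** Serves for the remainder that [residue_part] discards: its terms lie in several classes, and
    only their absence from class [j] matters. *)
Definition avoids (F : fieldType) (q j : int) (f : laurent F) :=
  forall n, (n = j %[mod q])%Z -> f n = 0.

Section Support.
Variable F : fieldType.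
Implicit Types (f g : laurent F) (q j k : int).

Lemma residue_part_split (q j : nat) f g :
  supported q j f -> avoids q j g -> residue_part q j (f + g) = f.
Proof.
move=> fj gj; apply: laurentP => n /=; rewrite /residue_part_fun laurent_addE.
case: eqP => nj; first by rewrite gj ?addr0.
by apply/esym/eqP; apply: contra_notT nj => /fj.
Qed.

Lemma supported_avoids q j k f :
  supported q k f -> (j != k %[mod q])%Z -> avoids q j f.
Proof.
move=> fk jk n nj; apply/eqP; apply: contraNT jk => /fk nk.
by rewrite -nj nk.
Qed.

Lemma supported_eq0 q j f n :
  supported q j f -> (n != j %[mod q])%Z -> f n = 0.
Proof. by move=> fj; apply: contraNeq => /fj ->. Qed.

Lemma avoidsD q j f g : avoids q j f -> avoids q j g -> avoids q j (f + g).
Proof. by move=> fj gj n nj; rewrite laurent_addE fj ?gj ?addr0. Qed.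

Lemma supportedD q j f g :
  supported q j f -> supported q j g -> supported q j (f + g).
Proof.
move=> fj gj n; rewrite laurent_addE.
have [->|/fj //] := eqVneq (f n) 0.
by rewrite add0r => /gj.
Qed.

Lemma supportedM q j k f g :
  supported q j f -> supported q k g -> supported q (j + k) (f * g).
Proof.
move=> fj gk n; have -> : (f * g) n = laurent_mul_fun f g n by [].
apply: contra_neq_eq => njk; apply: fsbig1 => i _.
have [->|/fj ij] := eqVneq (f i) 0; first by rewrite mul0r.
have [->|/gk ik] := eqVneq (g (n - i)) 0; first by rewrite mulr0.
case/eqP: njk.
rewrite (_ : n = i + (n - i)); last by lia.
by rewrite -modzDm ij ik modzDm.
Qed.

Lemma supported_dvd q q' j f : (q' %| q)%Z -> supported q j f -> supported q' j f.
Proof.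
move=> qq fj n /fj /eqP; rewrite eqz_mod_dvd => nj; apply/eqP.
by rewrite eqz_mod_dvd (dvdz_trans qq).
Qed.

End Support.

Lemma supported_pow4 q j (f : laurent 'F_2) :
  supported q j f -> supported (4 * q) (4 * j) (f ^+ 4).
Proof.
move=> fj n; rewrite laurent_pow4E; case: ifP => [n4 /fj /eqP|]; last by rewrite eqxx.
rewrite eqz_mod_dvd => nj; apply/eqP; rewrite eqz_mod_dvd.
have -> : n - 4 * j = 4 * ((n %/ 4)%Z - j) by lia.
by rewrite dvdz_mul2l.
Qed.

(** Over ['F_2] the series [f ^+ 4] is [f(x^4)], and [4k = 4j] modulo [4q] forces [k = j] modulo
    [q]. *)
Lemma avoids_pow4 q j (f : laurent 'F_2) :
  avoids q j f -> avoids (4 * q) (4 * j) (f ^+ 4).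
Proof.
move=> fj n /eqP nj; rewrite laurent_pow4E; case: ifP => // n4; apply: fj.
apply/eqP; rewrite eqz_mod_dvd; move: nj; rewrite eqz_mod_dvd.
have -> : n - 4 * j = 4 * ((n %/ 4)%Z - j) by lia.
by rewrite dvdz_mul2l.
Qed.

Lemma pow4_supported (f : laurent 'F_2) : supported 4 0 (f ^+ 4).
Proof. by move=> n; rewrite laurent_pow4E; case: ifP; [lia|rewrite eqxx]. Qed.

Lemma sqr_supported (f : laurent 'F_2) : supported 2 0 (f ^+ 2).
Proof. by move=> n; rewrite laurent_sqrE; case: ifP; [lia|rewrite eqxx]. Qed.

Lemma pow8_supported (f : laurent 'F_2) : supported 8 0 (f ^+ 8).
Proof.
by rewrite (exprM f 2 4); exact: (supported_pow4 (@sqr_supported f)).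
Qed.

Lemma avoids_dvd (F : fieldType) q q' j k (f : laurent F) :
  (q' %| q)%Z -> (j = k %[mod q'])%Z -> avoids q' k f -> avoids q j f.
Proof.
move=> qq jk fk n /eqP; rewrite eqz_mod_dvd => nj; apply: fk; rewrite -jk.
by apply/eqP; rewrite eqz_mod_dvd (dvdz_trans qq).
Qed.

(** * Closure properties of the ring S *)

Lemma theta_ringD f g : theta_ring f -> theta_ring g -> theta_ring (f + g).
Proof.
move=> fS gS T TS; have fT := fS T TS; have gT := gS T TS.
case: TS => -[[T1 TB _] _] _.
(* [subring_closed] provides [1], differences and products; [0] and sums are recovered from
   differences. *)
have T0 : 0 \in T by rewrite -(subrr 1); exact: TB.
apply/set_mem; have -> : f + g = f - (0 - g) by rewrite sub0r opprK.
by apply: (TB); [exact/mem_set | apply: TB => //; exact/mem_set].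
Qed.

Lemma theta_ringM f g : theta_ring f -> theta_ring g -> theta_ring (f * g).
Proof.
move=> fS gS T TS; have fT := fS T TS; have gT := gS T TS.
by case: TS => -[[_ _ TM] _] _; apply/set_mem; apply: TM; apply/mem_set.
Qed.

Lemma theta_ringX f n : theta_ring f -> theta_ring (f ^+ n).
Proof.
move=> fS; elim: n => [|n IHn]; last by rewrite exprS; exact: theta_ringM.
by move=> T [[_ TC] _]; exact: TC.
Qed.

(** * Algebraic identities in characteristic 2 *)

Section CharTwoIdentities.
Variable K : fieldType.
Hypothesis two0 : 2 = 0 :> K.
Variables a b : K.
Hypothesis a_neq0 : a != 0.
Let A := a + b ^+ 4.
Let B := b + a ^+ 4.
Let p := a * b.
Let s := a ^+ 5 + b ^+ 5.

(** The only use of characteristic 2 in this section: each identity modulo 2 is checked as an exact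
    one with an explicit correction [2 * z]. *)
Let ring2 (x y z : K) : x = y + 2 * z -> x = y.
Proof. by rewrite two0 mul0r addr0. Qed.

Lemma odd_even_sum : s = B * b ^+ 4 + A * a ^+ 4.
Proof.
apply: (@ring2 _ _ (- (a ^+ 4 * b ^+ 4))); rewrite /s /A /B; ring.
Qed.

(** Expand [(A + b^4)^3 / a^4]: the term [b^12 / a^4] is the fourth power. The other numerators are
    powers [A^3], [A^2], [A] times fourth powers, which places them in classes 3, 2, 1 modulo 4. *)
Lemma inv_decomposition : a^-1 = (b ^+ 3 / a) ^+ 4 +
  (A ^+ 3 + A ^+ 2 * b ^+ 4 + A * (b ^+ 2) ^+ 4) / a ^+ 4.
Proof.
apply: (@ring2 _ _ ((- 2 * A ^+ 2 * b ^+ 4 + A * b ^+ 8 - b ^+ 12) / a ^+ 4)).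
by rewrite /A; field.
Qed.

(* For [t = s + p + p^2] the hypothesis amounts to [t^2 = t]. *)
Lemma curve_quadratic : s ^+ 2 = A * B ->
  (s + p + p ^+ 2) * (s + p + p ^+ 2 - 1) = 0.
Proof.
have -> : A * B = p + s + p ^+ 4 by rewrite /A /B /s /p; ring.
move/eqP; rewrite -subr_eq0 => /eqP <-.
apply: (@ring2 _ _ (s * p + s * p ^+ 2 + p ^+ 3 + p ^+ 4)).
by move: s p => s' p'; ring.
Qed.

(** Modulo 2, [A * B] expands to [p + s + p^4]. This form isolates [p] as the odd-exponent
    contribution to [s] when [A * B] and [p^4] have even exponents. *)
Lemma curve_sum : s = p + A * B + p ^+ 4.
Proof.
apply: (@ring2 _ _ (- (p + p ^+ 4))); rewrite /s /p /A /B; ring.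
Qed.

Hypothesis sE : s = p + p ^+ 2.

(** Modulo 2 both sides become [p^2 + p^4]. *)
Lemma s_sqrE : s ^+ 2 = A * B.
Proof.
have -> : A * B = p + s + p ^+ 4 by rewrite /A /B /s /p; ring.
rewrite sE; apply: (@ring2 _ _ (p ^+ 3 - p)); ring.
Qed.

Lemma cube_div_decomposition : b ^+ 3 / a =
  s * b ^+ 4 + s ^+ 2 * (A + B * b ^+ 8) + (s ^+ 6 * B / a ^+ 8 + b ^+ 4).
Proof.
(* Powers of [p] are traded for powers of [s], whose exponents are controlled; the cube of
   [s = p + p^2] gives [p^3 = s^3 + s p^4 + p^4]. *)
have -> : b ^+ 3 / a = s ^+ 3 / a ^+ 4 + s * b ^+ 4 + b ^+ 4.
  have -> : b ^+ 3 / a = p ^+ 3 / a ^+ 4 by rewrite /p; field.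
  have -> : p ^+ 3 = s ^+ 3 + s * p ^+ 4 + p ^+ 4.
    rewrite sE; apply: (@ring2 _ _ (- (2 * p ^+ 4 + 2 * p ^+ 5 + p ^+ 6))); ring.
  by rewrite [p ^+ 4]exprMn; move: s => s'; field.
(* Only one of the three factors [s] is replaced by [B b^4 + A a^4]. *)
have -> : s ^+ 3 / a ^+ 4 = s ^+ 2 * (A + B * (p ^+ 4 / a ^+ 8)).
  rewrite exprSr {2}odd_even_sum [p ^+ 4]exprMn.
  by move: s A B => s' A' B'; field.
(* The fourth power of [p = s + p^2], divided by [a^8]. *)
have -> : p ^+ 4 / a ^+ 8 = s ^+ 4 / a ^+ 8 + b ^+ 8.
  have -> : p ^+ 4 = s ^+ 4 + p ^+ 8.
    rewrite sE; apply: (@ring2 _ _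
      (- (2 * p ^+ 5 + 3 * p ^+ 6 + 2 * p ^+ 7 + p ^+ 8))); ring.
  by rewrite [p ^+ 8]exprMn; move: s => s'; field.
by move: s A B => s' A' B'; field.
Qed.

End CharTwoIdentities.

(** * Residue parts of the inverse of [a] *)

Section EvenOddRelations.
Variables a b : laurent 'F_2.
Hypothesis a_neq0 : a != 0.
Hypothesis odd_a : supported 8 1 (a + b ^+ 4).
Hypothesis odd_b : supported 8 1 (b + a ^+ 4).
Let s := a ^+ 5 + b ^+ 5.
Let p := a * b.

Let two0 : 2 = 0 :> laurent 'F_2.
Proof. by rewrite -(laurent_addff 1). Qed.

Let A := a + b ^+ 4.
Let B := b + a ^+ 4.

(** Placed before the hypothesis [sE] because, for the theta series, [sE] is itself derived with the
    help of this fact. *)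
Lemma curve_supported : supported 4 1 s.
Proof.
rewrite /s (odd_even_sum two0).
apply: supportedD; rewrite -[1]addr0; apply: supportedM; try exact: pow4_supported.
  exact: supported_dvd odd_b.
exact: supported_dvd odd_a.
Qed.

Hypothesis sE : s = p + p ^+ 2.

Let s_supported : supported 4 1 s := @curve_supported.

Let s2_supported : supported 8 2 (s ^+ 2).
Proof. by rewrite (s_sqrE two0 sE) -[2]/(1 + 1); exact: supportedM. Qed.

Let pow4M_supported (f g : laurent 'F_2) j :
  supported 4 j g -> supported 4 j (f ^+ 4 * g).
Proof. by rewrite -{2}[j]add0r; apply: supportedM; exact: pow4_supported. Qed.

(** Dividing by [f ^+ 4] is multiplying by the fourth power of [f^-1], again a series in [x^4]. *)
Let pow4V_supported (f g : laurent 'F_2) j :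
  supported 4 j g -> supported 4 j (g / f ^+ 4).
Proof. by rewrite -exprVn mulrC; exact: pow4M_supported. Qed.

Let avoids_invE :
  avoids 4 0 ((A ^+ 3 + A ^+ 2 * b ^+ 4 + A * (b ^+ 2) ^+ 4) / a ^+ 4).
Proof.
have A1 : supported 4 1 A by exact: supported_dvd odd_a.
have A2 : supported 4 2 (A ^+ 2).
  by rewrite expr2 -[2]/(1 + 1); exact: supportedM.
have A3 : supported 4 3 (A ^+ 3).
  by rewrite exprS -[3]/(1 + 2); exact: supportedM.
rewrite 2!mulrDl; do 2?apply: avoidsD.
- exact: (supported_avoids (pow4V_supported A3)).
- by rewrite [A ^+ 2 * _]mulrC; apply: (supported_avoids (k := 2)) => //;
    exact/pow4V_supported/pow4M_supported.
- by rewrite [A * _]mulrC; apply: (supported_avoids (k := 1)) => //;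
    exact/pow4V_supported/pow4M_supported.
Qed.

Let s_b4_supported : supported 4 1 (s * b ^+ 4).
Proof. by rewrite -[1]addr0; apply: supportedM => //; exact: pow4_supported. Qed.

Let main_supported : supported 8 3 (s ^+ 2 * (A + B * b ^+ 8)).
Proof.
rewrite (_ : 3 = 2 + 1) //; apply: supportedM => //; apply: supportedD => //.
by rewrite -[1]addr0; apply: supportedM => //; exact: pow8_supported.
Qed.

(** Modulo 8 the factors [s^4], [s^2], [B] and [a^-8] have classes 4, 2, 1 and 0. *)
Let error_supported : supported 8 7 (s ^+ 6 * B / a ^+ 8).
Proof.
have -> : s ^+ 6 * B / a ^+ 8 = s ^+ 4 * s ^+ 2 * B * a^-1 ^+ 8.
  by rewrite exprVn -exprD.
rewrite (_ : 7 = 4 + 2 + 1 + 0) //; do 3?apply: supportedM => //.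
  by apply: (@supported_dvd _ 16) => //; exact: supported_pow4 curve_supported.
exact: pow8_supported.
Qed.

(** Class 4 modulo 16 lies in class 0 modulo 4, so only [(b^3 / a)^4] contributes, through class 1
    modulo 4 of [b^3 / a]. *)
Lemma residue_part_16_4 : residue_part 16 4 a^-1 = (s * b ^+ 4) ^+ 4.
Proof.
rewrite (inv_decomposition two0 b a_neq0).
rewrite (cube_div_decomposition two0 a_neq0 sE).
rewrite -addrA laurent_pow4D -addrA; apply: residue_part_split.
  exact: (@supported_pow4 4 1 _ s_b4_supported).
apply: avoidsD; last exact: (@avoids_dvd _ _ _ _ _ _ _ _ avoids_invE).
apply: (@avoids_pow4 4 1); do 2?apply: avoidsD.
- apply: (@supported_avoids _ _ _ 3) => //.
  exact: (supported_dvd _ main_supported).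
- apply: (@supported_avoids _ _ _ 7) => //.
  exact: (supported_dvd _ error_supported).
- exact: (@supported_avoids _ _ _ 0 _ (@pow4_supported b)).
Qed.

(** Here class 3 modulo 8 of [b^3 / a] is extracted; the modulus 8 separates the term in class 3
    from the one in class 7, which agree modulo 4. *)
Lemma residue_part_32_12 :
  residue_part 32 12 a^-1 = (s ^+ 2 * (A + B * b ^+ 8)) ^+ 4.
Proof.
rewrite (inv_decomposition two0 b a_neq0).
rewrite (cube_div_decomposition two0 a_neq0 sE).
rewrite (addrC (s * b ^+ 4)) -addrA laurent_pow4D -addrA.
apply: residue_part_split; first exact: (@supported_pow4 8 3 _ main_supported).
apply: avoidsD; last exact: (@avoids_dvd _ _ _ _ _ _ _ _ avoids_invE).
apply: (@avoids_pow4 8 3); do 2?apply: avoidsD.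
- apply: (@avoids_dvd _ _ 4 _ 3) => //.
  exact: (@supported_avoids _ _ _ 1 _ s_b4_supported).
- exact: (@supported_avoids _ _ _ 7 _ error_supported).
- apply: (@avoids_dvd _ _ 4 _ 3) => //.
  exact: (@supported_avoids _ _ _ 0 _ (@pow4_supported b)).
Qed.

End EvenOddRelations.

(** * Series of squares with roots in a prescribed set, and their products as counts of lattice
    points *)

Definition squares_fun (P : set int) (m : int) : 'F_2 :=
  \sum_(n \in [set n : int | P n /\ n ^+ 2 = m]) (1 : 'F_2).

Lemma squares_fun_eq0 (P : set int) (m : int) :
  (forall n, P n -> n ^+ 2 != m) -> squares_fun P m = 0.
Proof.
move=> Pm; rewrite /squares_fun (_ : [set n | _] = set0) ?fsbig_set0 //.
by apply/seteqP; split=> n //= -[/Pm/eqP].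
Qed.

Lemma squares_fun_vanish P : vanish_below 0 (squares_fun P).
Proof.
move=> m m0; apply: squares_fun_eq0 => n _.
by rewrite gt_eqF // (lt_le_trans m0) ?sqr_ge0.
Qed.

Definition squares (P : set int) : laurent 'F_2 :=
  Laurent (mem_laurent (@squares_fun_vanish P)).

Lemma eq_squares_fun (P Q : set int) (m : int) :
  (forall n, n ^+ 2 = m -> P n <-> Q n) -> squares_fun P m = squares_fun Q m.
Proof.
move=> PQ; apply: eq_fsbigl; apply/seteqP; split=> n /= [Pn nm]; split=> //;
  exact/PQ.
Qed.

Definition ints (K : nat) : seq int := [seq (k%:Z - K%:Z)%R | k <- iota 0 K.*2.+1].

Lemma ints_uniq K : uniq (ints K).
Proof. by rewrite map_inj_uniq ?iota_uniq // => i j; lia. Qed.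

Lemma mem_ints K (n : int) : (n \in ints K) = (`|n| <= K%:Z).
Proof.
apply/mapP/idP => [[k]|nK]; first by rewrite mem_iota => /andP[_ kK] ->; lia.
by exists (absz (n + K%:Z)%R); rewrite ?mem_iota; lia.
Qed.

Lemma normz_le_sqr (n : int) : `|n| <= n ^+ 2.
Proof. nia. Qed.

(** A root [n] of [k] has [|n| <= n^2 = k <= K], so the window misses none. Leaving [K] free lets
    one window serve all coefficients of a convolution. *)
Lemma squares_finE P (K k : nat) : (k <= K)%N ->
  squares P k = \sum_(n <- ints K) ((n \in P) && (n ^+ 2 == k))%:R.
Proof.
move=> kK; transitivity
    (\sum_(n <- ints K | (n \in P) && (n ^+ 2 == k%:Z)) (1 : 'F_2)); last first.
  by rewrite big_mkcond; apply: eq_bigr => n _; case: ifP.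
rewrite bigfs ?ints_uniq //; last first.
  move=> n /andP[_ /eqP nk]; rewrite mem_ints.
  by have := normz_le_sqr n; lia.
apply: eq_fsbigl; apply/seteqP; split=> n /=.
  by case=> Pn nk; apply/andP; split; [exact/mem_set | exact/eqP].
by case/andP=> /set_mem Pn /eqP.
Qed.

Definition pairs_fun (P Q : set int) (m : int) : 'F_2 :=
  \sum_(z \in [set z : int * int |
    [/\ P z.1, Q z.2 & z.1 ^+ 2 + z.2 ^+ 2 = m]]) (1 : 'F_2).

Lemma squares_mulE P Q m : (squares P * squares Q) m = pairs_fun P Q m.
Proof.
have -> : (squares P * squares Q) m = laurent_mul_fun (squares P) (squares Q) m.
  by [].
have P0 : vanish_below 0 (squares P) by exact: squares_fun_vanish.
have Q0 : vanish_below 0 (squares Q) by exact: squares_fun_vanish.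
have [m0|m0] := ltP m 0.
  rewrite (laurent_mul_fun_lt P0 Q0 m0) /pairs_fun.
  rewrite (_ : [set z | _] = set0) ?fsbig_set0 //.
  apply/seteqP; split=> z //= -[_ _ zm].
  by move: m0; rewrite -zm ltNge addr_ge0 ?sqr_ge0.
have {m0} [k ->] : exists k : nat, m = 0 + 0 + k%:Z by exists (absz m); lia.
rewrite (laurent_mul_funE _ P0 Q0) !add0r.
transitivity (\sum_(u <- ints k) \sum_(v <- ints k)
    ([&& u \in P, v \in Q & u ^+ 2 + v ^+ 2 == k%:Z])%:R : 'F_2).
  under eq_bigr => i _.
    rewrite (@squares_finE P k) ?leq_ord // (@squares_finE Q k) ?leq_subr //.
    rewrite big_distrlr /=.
    over.
  rewrite exchange_big /=; apply: eq_bigr => u _.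
  rewrite exchange_big /=; apply: eq_bigr => v _.
  have [uP|_] := boolP (u \in P); last first.
    by rewrite big1 // => i _; rewrite mul0r.
  have [vQ|_] := boolP (v \in Q); last first.
    by rewrite big1 // => i _; rewrite mulr0.
  move: (u ^+ 2) (v ^+ 2) (sqr_ge0 u) (sqr_ge0 v) => x y x0 y0 {P Q P0 Q0 uP vQ}.
  (* For a fixed pair [(u, v)] only the convolution index [i = u^2] can contribute, and it does so
     exactly when [u^2 + v^2 = k]. *)
  have [uvk|uvk] := boolP (x + y == k%:Z) => /=.
    have uk : (absz x < k.+1)%N by lia.
    rewrite (bigD1 (Ordinal uk)) //= big1 ?addr0 => [|i iu].
      have -> : x == `|x|%N :> int by lia.
      have -> : y == (k - `|x|)%N :> int by lia.
      by rewrite mulr1.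
    case: eqP => [ui|_]; last by rewrite mul0r.
    by case/eqP: iu; apply/val_inj => /=; lia.
  apply: big1 => i _; case: eqP => [ui|_]; last by rewrite mul0r.
  case: eqP => [vi|_]; last by rewrite mulr0.
  by case/eqP: uvk; rewrite ui vi; have := ltn_ord i; lia.
rewrite -(big_allpairs (F := fun z : int * int =>
  [&& z.1 \in P, z.2 \in Q & z.1 ^+ 2 + z.2 ^+ 2 == k%:Z]%:R)).
transitivity (\sum_(z <- [seq (u, v) | u <- ints k, v <- ints k] |
    [&& z.1 \in P, z.2 \in Q & z.1 ^+ 2 + z.2 ^+ 2 == k%:Z]) (1 : 'F_2)).
  by rewrite [RHS]big_mkcond; apply: eq_bigr => n _; case: ifP.
rewrite bigfs; first last.
- move=> [u v] /and3P[_ _ /eqP uvk] /negP[]; rewrite /= in uvk.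
  apply: (allpairs_f (fun u v : int => (u, v)));
    rewrite mem_ints; have := (normz_le_sqr u, normz_le_sqr v);
    move: (sqr_ge0 u) (sqr_ge0 v) uvk;
    by move: (u ^+ 2) (v ^+ 2) => x y ? ? ? [? ?]; lia.
- by apply: allpairs_uniq => [||[? ?] [? ?] _ _ []]; rewrite ?ints_uniq // => -> ->.
apply: eq_fsbigl; apply/seteqP; split=> z /=.
  by case/and3P=> /set_mem zP /set_mem zQ /eqP.
by case=> zP zQ zk; apply/and3P; split; [exact/mem_set | exact/mem_set | exact/eqP].
Qed.

(** * Even and odd parts of the theta series, and the lattice rotation *)

Lemma dvd2_sqr (n : int) : (2 %| n ^+ 2)%Z = (2 %| n)%Z.
Proof. by rewrite !dvdzE abszX Euclid_dvdX // andbT. Qed.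

Lemma theta_squares i : theta i = squares [set n | (n = i %[mod 5])%Z].
Proof. exact: laurentP. Qed.

Lemma theta_parityE i :
  theta i = squares [set n | (n = i %[mod 5])%Z /\ ~~ (2 %| n)%Z] +
            squares [set n | (n = i %[mod 5])%Z /\ (2 %| n)%Z].
Proof.
apply: laurentP => m; rewrite laurent_addE theta_squares /=.
case: (boolP (2 %| m)%Z) => m2.
  rewrite [X in _ = X + _]squares_fun_eq0 ?add0r; last first.
    by move=> n /= [_ n2]; apply: contraNneq n2 => nm; rewrite -dvd2_sqr nm.
  apply: eq_squares_fun => n /= nm; split => [ni|[]//]; split=> //.
  by rewrite -dvd2_sqr nm.
rewrite [X in _ = _ + X]squares_fun_eq0 ?addr0; last first.
  by move=> n /= [_ n2]; apply: contraNneq m2 => <-; rewrite dvd2_sqr.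
apply: eq_squares_fun => n /= nm; split => [ni|[]//]; split=> //.
by rewrite -dvd2_sqr nm.
Qed.

Lemma odd_squares_supported (P : set int) :
  supported 8 1 (squares [set n | P n /\ ~~ (2 %| n)%Z]).
Proof.
move=> m; apply: contra_neq_eq => m1; apply: squares_fun_eq0 => n /= [_ n2].
apply: contra_neq m1 => <-.
have -> : n = 2 * (n %/ 2)%Z + 1 by lia.
move: (n %/ 2)%Z => k.
have -> : (2 * k + 1) ^+ 2 = 4 * (k * (k + 1)) + 1 by ring.
have : (2 %| k * (k + 1))%Z.
  have [k2|k2] : (2 %| k)%Z \/ (2 %| k + 1)%Z by lia.
    exact: dvdz_mulr.
  exact: dvdz_mull.
by move: (k * (k + 1)) => x; lia.
Qed.

(** Even roots are doubled roots, so exponents are multiplied by 4, as under a fourth power. Squares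
    ignore signs, whence the two alternatives; the second covers [1 = -(2 * 2)] modulo 5. *)
Lemma even_squares_theta i j : (i = 2 * j %[mod 5])%Z \/ (i = - (2 * j) %[mod 5])%Z ->
  squares [set n | (n = i %[mod 5])%Z /\ (2 %| n)%Z] = theta j ^+ 4.
Proof.
move=> ij; apply: laurentP => m; rewrite laurent_pow4E; case: ifPn => m4.
  have [c c1 ijc] : exists2 c, c = 1 \/ c = -1 & (i = 2 * (c * j) %[mod 5])%Z.
    by case: ij; [exists 1 | exists (-1)]; lia.
  rewrite /= /squares_fun /theta_fun.
  apply: (reindex_fsbig (fun n => 2 * (c * n))); split.
  - move=> n /= [nj nm]; split; last by case: c1 => ->; nia.
    by split; [case: c1 ijc => -> | exact: dvdz_mulr]; lia.
  - by move=> n n' _ _; case: c1 => ->; lia.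
  - move=> n /= [[ni n2] nm].
    have [k nE] : exists k, n = 2 * k by exists (n %/ 2)%Z; lia.
    have mE : m = 4 * k ^+ 2 by rewrite -nm nE; ring.
    exists (c * k); last by case: c1 => ->; lia.
    split; first by case: c1 ijc => ->; lia.
    by rewrite mE mulKz // exprMn; case: c1 => ->; rewrite ?sqrrN expr1n mul1r.
apply: squares_fun_eq0 => n /= [_ n2]; apply: contraNneq m4 => <-.
have [k ->] : exists k, n = 2 * k by exists (n %/ 2)%Z; lia.
by rewrite exprMn dvdz_mulr.
Qed.

Lemma theta_oddE i j : (i = 2 * j %[mod 5])%Z \/ (i = - (2 * j) %[mod 5])%Z ->
  theta i + theta j ^+ 4 = squares [set n | (n = i %[mod 5])%Z /\ ~~ (2 %| n)%Z].
Proof.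
by move=> ij; rewrite theta_parityE (even_squares_theta ij) -addrA laurent_addff addr0.
Qed.

Lemma theta_odd1 :
  theta 1 + theta 2 ^+ 4 = squares [set n | (n = 1 %[mod 5])%Z /\ ~~ (2 %| n)%Z].
Proof. by apply: theta_oddE; right. Qed.

Lemma theta_odd2 :
  theta 2 + theta 1 ^+ 4 = squares [set n | (n = 2 %[mod 5])%Z /\ ~~ (2 %| n)%Z].
Proof. by apply: theta_oddE; left. Qed.

Lemma theta_odd1_supported : supported 8 1 (theta 1 + theta 2 ^+ 4).
Proof. by rewrite theta_odd1; exact: odd_squares_supported. Qed.

Lemma theta_odd2_supported : supported 8 1 (theta 2 + theta 1 ^+ 4).
Proof. by rewrite theta_odd2; exact: odd_squares_supported. Qed.

(* The rotation [(u, v) |-> (v - u, - u - v)] doubles [u^2 + v^2] and fixes the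
   residues [(1, 2)] modulo 5. *)
Lemma theta_mul_rotation (m : int) : ~~ (2 %| m)%Z ->
  (theta 1 * theta 2) m =
  ((theta 1 + theta 2 ^+ 4) * (theta 2 + theta 1 ^+ 4)) (2 * m).
Proof.
move=> m2; rewrite theta_odd1 theta_odd2 !theta_squares !squares_mulE.
apply/esym/(reindex_fsbig (fun z => (z.2 - z.1, - z.1 - z.2))); split.
- case=> u v /= [u1 v2 uvm].
  have sum_odd : ~~ (2 %| u + v)%Z.
    have -> : (2 %| u + v)%Z = (2 %| m + 2 * (u * v))%Z.
      by rewrite -dvd2_sqr -uvm; congr dvdz; ring.
    by move: (u * v) => w; lia.
  split; [split; lia|split; lia|].
  by rewrite -uvm; ring.
- by case=> u v [u' v'] _ _ /= []; move=> *; congr pair; lia.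
- case=> u v /= [[u1 u2] [v1 v2] uvm].
  have [x xE] : exists x, u + v = 2 * x by clear -u2 v2; exists ((u + v) %/ 2)%Z; lia.
  have [y yE] : exists y, v - u = 2 * y by clear -u2 v2; exists ((v - u) %/ 2)%Z; lia.
  have uE : u = x - y by lia.
  have vE : v = x + y by lia.
  exists (- x, - y); last by congr pair => /=; lia.
  have xym : x ^+ 2 + y ^+ 2 = m.
    by apply: (@mulfI _ 2) => //; rewrite -uvm uE vE; ring.
  by rewrite /= !sqrrN; clear -u1 v1 uE vE xym; split=> //; lia.
Qed.

(** * The curve relation between [theta 1] and [theta 2] *)

Lemma theta_odd_mul : (theta 1 ^+ 5 + theta 2 ^+ 5) ^+ 2 =
  (theta 1 + theta 2 ^+ 4) * (theta 2 + theta 1 ^+ 4).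
Proof.
have AB2 := supportedM theta_odd1_supported theta_odd2_supported.
have s1 : supported 4 1 (theta 1 ^+ 5 + theta 2 ^+ 5).
  exact: curve_supported theta_odd1_supported theta_odd2_supported.
(* The right side has exponents in class 2 modulo 8, and the left side is twice class 1 modulo 4, so
   only exponents [m] with [m / 2] odd remain to be compared. *)
apply: laurentP => m; rewrite laurent_sqrE; case: ifPn => [m2|m2]; last first.
  by rewrite (supported_eq0 AB2) //; lia.
have [m4|m4] := boolP (2 %| m %/ 2)%Z.
  by rewrite (supported_eq0 s1) ?(supported_eq0 AB2) //; lia.
(* At the odd exponent [m / 2] the last two terms vanish; the coefficient of the product
   [theta 1 * theta 2] is then moved to [m] by the rotation. *)
have -> : theta 1 ^+ 5 + theta 2 ^+ 5 = theta 1 * theta 2 +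
    (theta 1 + theta 2 ^+ 4) * (theta 2 + theta 1 ^+ 4) + (theta 1 * theta 2) ^+ 4.
  by apply: curve_sum; rewrite -(laurent_addff 1).
rewrite 2!laurent_addE (supported_eq0 AB2); last by lia.
rewrite (supported_eq0 (@pow4_supported _)); last by lia.
by rewrite !addr0 theta_mul_rotation //; congr (_ _); lia.
Qed.

Lemma theta_vanish1 i : ~~ (5 %| i)%Z -> vanish_below 1 (theta i).
Proof.
move=> i5 m m1; apply: squares_fun_eq0 => n /= ni.
apply: contraNneq i5 => nm.
have n0 : n = 0 by apply/eqP; rewrite -sqrf_eq0 eq_le sqr_ge0 nm andbT; lia.
by move: ni; rewrite n0; lia.
Qed.

(** At exponent [i^2] the root [i] counts and [-i] does not, since [i] and [-i] differ modulo 5; the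
    coefficient is 1. *)
Lemma theta_neq0 i : ~~ (5 %| i)%Z -> theta i != 0.
Proof.
move=> i5; apply/eqP => /(congr1 (fun f => lcoef f (i ^+ 2))) /=.
rewrite /theta_fun (_ : [set n : int | _] = [set i]) ?fsbig_set1 //.
apply/seteqP; split=> n /= [ni]; last by rewrite ni.
by move/eqP; rewrite eqf_sqr => /orP[/eqP //|/eqP nE]; move: ni; rewrite nE; lia.
Qed.

(** Laurent series form a field, so [t = s + p + p^2] is 0 or 1. Its constant term vanishes, because
    [s] lives in class 1 modulo 4 and [p] starts beyond exponent 0; hence [t = 0]. *)
Lemma theta_curve : theta 1 ^+ 5 + theta 2 ^+ 5 =
  theta 1 * theta 2 + (theta 1 * theta 2) ^+ 2.
Proof.
have two0 : 2 = 0 :> laurent 'F_2 by rewrite -(laurent_addff 1).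
have s1 : supported 4 1 (theta 1 ^+ 5 + theta 2 ^+ 5).
  exact: curve_supported theta_odd1_supported theta_odd2_supported.
have := curve_quadratic two0 theta_odd_mul.
have p0 : (theta 1 * theta 2) 0 = 0.
  exact: (laurent_mul_fun_lt (@theta_vanish1 1 _) (@theta_vanish1 2 _)).
move/eqP; rewrite mulf_eq0 => /orP[]; last first.
  rewrite subr_eq0 => /eqP /(congr1 (fun f => lcoef f 0)) /eqP.
  by rewrite 2!laurent_addE p0 (supported_eq0 s1) // laurent_sqrE div0z p0.
rewrite -addrA addr_eq0 => /eqP ->; apply/eqP.
by rewrite eq_sym -addr_eq0 laurent_addff.
Qed.

(** Stated for abstract [a] and [b] so that it applies to both orders of [theta 1] and [theta 2]. *)
Lemma theta_ring_residues (a b : laurent 'F_2) :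
  a != 0 -> supported 8 1 (a + b ^+ 4) -> supported 8 1 (b + a ^+ 4) ->
  a ^+ 5 + b ^+ 5 = a * b + (a * b) ^+ 2 -> theta_ring a -> theta_ring b ->
  theta_ring (residue_part 16 4 a^-1) /\ theta_ring (residue_part 32 12 a^-1).
Proof.
move=> a0 oa ob ab aS bS.
rewrite (residue_part_16_4 a0 oa ob ab) (residue_part_32_12 a0 oa ob ab).
by split; do ?[exact: aS | exact: bS | apply: theta_ringX | apply: theta_ringM
  | apply: theta_ringD].
Qed.

Theorem theorem4p4 (r : int) (hr : r = 1 \/ r = 2) :
  let a := theta r in
  theta_ring (residue_part 16 4 a^-1) /\ theta_ring (residue_part 32 12 a^-1).
Proof.
have S1 : theta_ring (theta 1) by apply: sub_gen_smallest; left.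
have S2 : theta_ring (theta 2) by apply: sub_gen_smallest; right.
case: hr => ->.
  exact: (theta_ring_residues (theta_neq0 _)
    (@theta_odd1_supported) (@theta_odd2_supported) theta_curve).
apply: (theta_ring_residues (theta_neq0 _)
  (@theta_odd2_supported) (@theta_odd1_supported)) => //.
by rewrite addrC theta_curve (mulrC (theta 2)).
Qed.
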